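(* Let $\chi$ be the state space, let $\{A_i\}_{i=1}^n$ be a finite partition of $\chi$ into (nonempty, measurable) sets, let $b$ be a positive function on $\chi$, and let $\mu_1,\dots,\mu_n$ be non-zero finite measures on $\chi$. Let $\tilde{\mathcal L}$ be the operator $$\tilde{\mathcal L}\phi(x)=b(x)\sum_{i=1}^n1_{A_i}(x)\int_\chi\phi(s)\,\mu_i(ds).$$ Let $r>0$. In order for $\tilde{\mathcal L}$ to have an $r$-sub-eigenfunction, it is necessary and sufficient that the $n\times n$ matrix $$Q(i,j)=\int_{A_j}b(x)\,\mu_i(dx)$$ has an $r$-sub-eigenvector $p=(p_1,\dots,p_n)^t$, that is, $p_i>0$ for all $i$ and $Qp\le rp$ (componentwise). Moreover, if $p$ is an $r$-sub-eigenvector for $Q$, then the function $$\phi(x)=\sum_{j=1}^np_j1_{A_j}(x)b(x)$$ (and any positive multiple of it) is an $r$-sub-eigenfunction for $\tilde{\mathcal L}$.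
   Context: An $r$-sub-eigenfunction of a positive linear operator $\mathcal L$ acting on functions on $\chi$ is a (measurable, real-valued) function $\phi>0$ on $\chi$ satisfying $\mathcal L\phi(x)\le r\phi(x)$ for all $x\in\chi$. Functions are assumed measurable; the state space $\chi$ is a complete separable metric space. *)

(* Defs.v *)
From HB Require Import structures.
From mathcomp Require Import all_boot all_order all_algebra.
From mathcomp Require Import all_classical all_reals all_analysis.

Set Implicit Arguments.
Unset Strict Implicit.
Unset Printing Implicit Defensive.

Import Order.TTheory GRing.Theory Num.Theory.
Import numFieldNormedType.Exports.

Local Open Scope classical_set_scope.
Local Open Scope ring_scope.

#[short(type="completeMetricType")]
HB.structure Definition CompleteMetric (K : numDomainType) :=
  {T of Metric K T & Complete T}.

Definition separable (T : topologicalType) : Prop :=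
  exists2 D : set T, countable D & dense D.

Definition borelType (T : ptopologicalType) : measurableType _ :=
  g_sigma_algebraType (@open T).

(* Operators take values in the extended reals because the integral of a
   positive measurable function may diverge. *)
Definition sub_eigenfunction (R : realType) (d : measure_display)
    (T : measurableType d) (L : (T -> R) -> T -> \bar R) (r : R)
    (phi : T -> R) : Prop :=
  [/\ measurable_fun [set: T] phi,
      forall x, 0 < phi x
    & forall x, (L phi x <= (r * phi x)%:E)%E].

(* Entries may be +oo, in which case the inequality fails since p > 0. *)
Definition sub_eigenvector (R : realType) (n : nat) (Q : 'M[\bar R]_n) (r : R)
    (p : 'cV[R]_n) : Prop :=
  (forall i, 0 < p i 0) /\
  (forall i, (\sum_(j < n) Q i j * (p j 0)%:E <= (r * p i 0)%:E)%E).

(* When the integral over a cell not containing x is +oo, the convention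
   0 * +oo = 0 makes its term vanish. *)
Definition cellwise_op (R : realType) (d : measure_display)
    (T : measurableType d) (n : nat) (A : 'I_n -> set T) (b : T -> R)
    (mu : 'I_n -> {finite_measure set T -> \bar R}) (phi : T -> R) (x : T) :
    \bar R :=
  ((b x)%:E *
   \sum_(i < n) ((\1_(A i) x)%:E * \int[mu i]_s (phi s)%:E))%E.

Definition cell_matrix (R : realType) (d : measure_display)
    (T : measurableType d) (n : nat) (A : 'I_n -> set T) (b : T -> R)
    (mu : 'I_n -> {finite_measure set T -> \bar R}) : 'M[\bar R]_n :=
  \matrix_(i < n, j < n) (\int[mu i]_(x in A j) (b x)%:E)%E.

Definition cell_fun (R : realType) (T : Type) (n : nat) (A : 'I_n -> set T)
    (b : T -> R) (p : 'cV[R]_n) (x : T) : R :=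
  \sum_(j < n) p j 0 * \1_(A j) x * b x.

(* A library measure is a function on all sets that is only constrained on the
   measurable ones, so being non-zero is tested on the total mass rather than
   by comparing functions with mzero. *)
Definition nonzero_measure (R : realType) (d : measure_display)
    (T : measurableType d) (mu : {finite_measure set T -> \bar R}) : Prop :=
  mu [set: T] != 0%E.

(* Main.v *)
Require Import Defs.
From mathcomp Require Import all_boot all_order all_algebra.
From mathcomp Require Import all_classical all_reals all_analysis.
From mathcomp Require Import measurable_realfun.

(** At a point of [A i] the operator only sees the number
    [\int[mu i] phi]: [cellwise_op] sends [phi] to [b x * \int[mu i] phi]
    there.  So the sub-eigenfunction inequality on the cell [A i] is
    [b * \int[mu i] phi <= r * phi], and everything is carried by the vector
    of the [n] integrals [\int[mu i] phi].

    Necessity: put [p i := \int[mu i] phi].  It is finite because a cell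
    contains a point, where [b x * p i] is below the real number [r * phi x],
    and it is positive because [phi > 0] and [mu i] is non-zero.  Integrating
    the inequality over each cell [A j] against [mu i] and summing over [j]
    gives exactly [Q p <= r p].

    Sufficiency: [cell_fun] is [p i * b] on [A i], hence its integral against
    [mu i] is the [i]-th coordinate of [Q p] ([integral_cell_fun]); on [A i],
    the operator thus sends it to [b * (Q p) i <= b * r * p i], which is [r]
    times the function.  Positive multiples come for free, the operator
    being positively homogeneous. *)

Import Order.TTheory GRing.Theory Num.Theory.
Import numFieldNormedType.Exports.

Local Open Scope classical_set_scope.
Local Open Scope ring_scope.

(** A function with integral zero vanishes almost everywhere; a nowhere
    vanishing one would then make the whole space negligible. *)
Lemma integral_gt0 (R : realType) (d : measure_display) (T : measurableType d)
    (m : {measure set T -> \bar R}) (f : T -> R) :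
  m [set: T] != 0%E -> measurable_fun [set: T] f -> (forall x, 0 < f x) ->
  (0 < \int[m]_x (f x)%:E)%E.
Proof.
move=> m0 mf f0.
have ge0 : (0 <= \int[m]_x (f x)%:E)%E.
  by apply: integral_ge0 => x _; rewrite lee_fin ltW.
rewrite lt_neqAle ge0 andbT eq_sym; apply/eqP => intf0.
have mEf : measurable_fun [set: T] (fun x => (f x)%:E) by exact/measurable_EFinP.
have absf : (\int[m]_x `|(f x)%:E| = 0)%E.
  rewrite -[RHS]intf0; apply: eq_integral => x _.
  by rewrite /= ger0_norm// ltW.
have /ae_eq_integral_abs - /(_ measurableT mEf) := absf.
case=> N [mN mN0 sub].
move/eqP: m0; apply; apply/eqP; rewrite -measure_le0 -[leRHS]mN0.
apply: le_measure; rewrite ?inE// => x _; apply: sub => /= /(_ I) [fx0].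
by have := f0 x; rewrite fx0 ltxx.
Qed.

Section FinitePartition.
Context {R : realType} {d : measure_display} {T : measurableType d}.
Context {n : nat} {A : 'I_n -> set T}.
Hypothesis partA : partition [set: 'I_n] A [set: T].

Lemma partition_cell (x : T) : exists i, A i x.
Proof.
case: partA => + _ _ => /seteqP[_ /(_ x I)] [i _ Aix].
by exists i.
Qed.

Lemma partition_indic (i j : 'I_n) (x : T) :
  A i x -> \1_(A j) x = (j == i)%:R :> R.
Proof.
move=> Aix; have [->|ji] := eqVneq j i.
  by rewrite indicE mem_set.
rewrite indicE memNset// => Ajx; move/eqP: ji; apply.
by case: partA => _ /(_ j i I I) + _; apply; exists x.
Qed.

Lemma integral_partition (m : {measure set T -> \bar R}) (f : T -> \bar R) :
  (forall i, measurable (A i)) -> measurable_fun [set: T] f ->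
  (forall x, (0 <= f x)%E) ->
  (\int[m]_x f x = \sum_(i < n) \int[m]_(x in A i) f x)%E.
Proof.
move=> mA mf f0.
have UA : [set: T] = \big[setU/set0]_(i <- index_enum 'I_n) A i.
  rewrite -bigcup_seq; apply/seteqP; split=> // x _.
  by have [i Aix] := partition_cell x; exists i => //=; rewrite mem_index_enum.
rewrite [in LHS]UA ge0_integral_bigsetU//.
- exact: index_enum_uniq.
- by case: partA => _ tA _ i j _ _; exact: tA.
- by rewrite -UA.
Qed.

Variables (b : T -> R) (mu : 'I_n -> {finite_measure set T -> \bar R}).
Hypothesis mA : forall i, measurable (A i).
Hypothesis mb : measurable_fun [set: T] b.
Hypothesis b_gt0 : forall x, 0 < b x.

(** Every other term of the sum is [0 * \int[mu j] phi], which is zero even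
    when the integral is infinite. *)
Lemma cellwise_opE (phi : T -> R) (i : 'I_n) (x : T) : A i x ->
  cellwise_op A b mu phi x = ((b x)%:E * \int[mu i]_s (phi s)%:E)%E.
Proof.
move=> Aix; rewrite /cellwise_op (bigD1 i)//= big1 ?adde0.
  by rewrite (partition_indic i i x Aix) eqxx mul1e.
by move=> j /negbTE ji; rewrite (partition_indic i j x Aix) ji mul0e.
Qed.

Lemma cell_funE (p : 'cV[R]_n) (i : 'I_n) (x : T) : A i x ->
  cell_fun A b p x = p i 0 * b x.
Proof.
move=> Aix; rewrite /cell_fun (bigD1 i)//= big1 ?addr0.
  by rewrite (partition_indic i i x Aix) eqxx mulr1.
by move=> j /negbTE ji; rewrite (partition_indic i j x Aix) ji mulr0 mul0r.
Qed.

Lemma measurable_cell_fun (p : 'cV[R]_n) :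
  measurable_fun [set: T] (cell_fun A b p).
Proof.
apply: measurable_sum => j.
by apply: measurable_funM => //; apply: measurable_funM.
Qed.

Lemma cell_fun_gt0 (p : 'cV[R]_n) :
  (forall i, 0 < p i 0) -> forall x, 0 < cell_fun A b p x.
Proof.
move=> p0 x; have [i Aix] := partition_cell x.
by rewrite (cell_funE p i x Aix) mulr_gt0.
Qed.

(** The coordinates of the matrix-vector product are the integrals of
    [cell_fun]; this is what turns the matrix inequality into one for the
    operator. *)
Lemma integral_cell_fun (p : 'cV[R]_n) (i : 'I_n) : (forall j, 0 < p j 0) ->
  (\int[mu i]_x (cell_fun A b p x)%:E
   = \sum_(j < n) cell_matrix A b mu i j * (p j 0)%:E)%E.
Proof.
move=> p0; rewrite integral_partition//.
- apply: eq_bigr => j _; rewrite mxE -ge0_integralZr//.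
  + apply: eq_integral => x /set_mem Ajx.
    by rewrite (cell_funE p j x Ajx) mulrC EFinM.
  + by apply/measurable_EFinP; exact: measurable_funTS.
  + by move=> x _; rewrite lee_fin ltW.
  + by rewrite lee_fin ltW.
- by apply/measurable_EFinP; exact: measurable_cell_fun.
- by move=> x; rewrite lee_fin ltW// cell_fun_gt0.
Qed.

Lemma sub_eigenfunctionZ (r c : R) (phi : T -> R) : 0 < c ->
  sub_eigenfunction (cellwise_op A b mu) r phi ->
  sub_eigenfunction (cellwise_op A b mu) r (fun x => c * phi x).
Proof.
move=> c0 [mphi phi0 Lphi]; split.
- exact: measurable_funM.
- by move=> x; rewrite mulr_gt0.
- move=> x; have [i Aix] := partition_cell x.
  rewrite (cellwise_opE _ i x Aix).
  under eq_integral do rewrite EFinM.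
  rewrite ge0_integralZl//; last 3 first.
  + exact/measurable_EFinP.
  + by move=> y _; rewrite lee_fin ltW.
  + by rewrite lee_fin ltW.
  rewrite muleCA -(cellwise_opE phi i x Aix) mulrCA EFinM.
  by rewrite lee_pmul2l ?lte_fin.
Qed.

Lemma sub_eigenfunction_cell_fun (r : R) (p : 'cV[R]_n) :
  sub_eigenvector (cell_matrix A b mu) r p ->
  sub_eigenfunction (cellwise_op A b mu) r (cell_fun A b p).
Proof.
move=> [p0 Qp]; split.
- exact: measurable_cell_fun.
- exact: cell_fun_gt0.
- move=> x; have [i Aix] := partition_cell x.
  rewrite (cellwise_opE _ i x Aix) integral_cell_fun// (cell_funE p i x Aix).
  by rewrite mulrA mulrC EFinM lee_pmul2l// lte_fin.
Qed.

(** The real vector [fine (\int[mu i] phi)] is meaningful only because the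
    sub-eigenfunction inequality at a single point of the nonempty cell [A i]
    forces that integral to be finite. *)
Lemma sub_eigenvector_integral (r : R) (phi : T -> R) :
  (forall i, nonzero_measure (mu i)) -> 0 < r ->
  sub_eigenfunction (cellwise_op A b mu) r phi ->
  sub_eigenvector (cell_matrix A b mu) r
    (\col_i fine (\int[mu i]_x (phi x)%:E)).
Proof.
move=> mu0 r0 [mphi phi0 Lphi].
have mEphi : measurable_fun [set: T] (fun x => (phi x)%:E).
  exact/measurable_EFinP.
have int0 i : (0 < \int[mu i]_x (phi x)%:E)%E.
  by apply: integral_gt0 => //; exact: mu0.
have Lcell i x : A i x ->
    ((b x)%:E * \int[mu i]_s (phi s)%:E <= (r * phi x)%:E)%E.
  by move=> Aix; rewrite -cellwise_opE.
have intfin i : (\int[mu i]_x (phi x)%:E)%E \is a fin_num.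
  rewrite gt0_fin_numE//; have [x Aix] : A i !=set0 by case: partA => _ _; apply.
  rewrite ltey; apply/eqP => intoo; have := Lcell i x Aix.
  by rewrite intoo gt0_muley ?lte_fin// leye_eq.
split=> i; first by rewrite mxE fine_gt0// int0 ltey_eq intfin.
rewrite mxE EFinM fineK// -ge0_integralZl//; last 2 first.
- by move=> x _; rewrite lee_fin ltW.
- by rewrite lee_fin ltW.
rewrite integral_partition//; last 2 first.
- exact: measurable_funeM.
- by move=> x; rewrite -EFinM lee_fin mulr_ge0// ltW.
(* Both sides are now sums over the cells; on [A j] it suffices to integrate
   [b * \int[mu j] phi <= r * phi] against [mu i]. *)
apply: lee_sum => j _; rewrite !mxE fineK// -ge0_integralZr//; last 3 first.
- by apply/measurable_EFinP; exact: measurable_funTS.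
- by move=> x _; rewrite lee_fin ltW.
- exact: ltW.
apply: ge0_le_integral => //.
- by move=> x _; rewrite mule_ge0 ?lee_fin// ltW.
- apply: emeasurable_funM => //.
  by apply/measurable_EFinP; exact: measurable_funTS.
- by apply: measurable_funeM; exact: measurable_funTS.
- by move=> x Ajx; rewrite -EFinM; exact: Lcell.
Qed.

End FinitePartition.

Theorem theorem6 (R : realType) (chi : completeMetricType R)
  (hsep : separable chi)
  (n : nat) (A : 'I_n -> set (borelType chi))
  (hA : partition [set: 'I_n] A [set: borelType chi])
  (mA : forall i, measurable (A i))
  (b : borelType chi -> R)
  (mb : measurable_fun [set: borelType chi] b)
  (hb : forall x, 0 < b x)
  (mu : 'I_n -> {finite_measure set (borelType chi) -> \bar R})
  (hmu : forall i, nonzero_measure (mu i))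
  (r : R) (hr : 0 < r) :
  ((exists phi : borelType chi -> R,
      sub_eigenfunction (cellwise_op A b mu) r phi) <->
   (exists p : 'cV[R]_n, sub_eigenvector (cell_matrix A b mu) r p)) /\
  (forall p : 'cV[R]_n, sub_eigenvector (cell_matrix A b mu) r p ->
     sub_eigenfunction (cellwise_op A b mu) r (cell_fun A b p) /\
     (forall c : R, 0 < c ->
        sub_eigenfunction (cellwise_op A b mu) r
          (fun x => c * cell_fun A b p x))).
Proof.
split; first split.
- move=> [phi phiP]; exists (\col_i fine (\int[mu i]_x (phi x)%:E)).
  exact: sub_eigenvector_integral.
- by move=> [p pP]; exists (cell_fun A b p); exact: sub_eigenfunction_cell_fun.
- move=> p pP; split; first exact: sub_eigenfunction_cell_fun.
  move=> c c0; apply: sub_eigenfunctionZ => //.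
  exact: sub_eigenfunction_cell_fun.
Qed.
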